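(* Let $p\ge 2$ and let $S\subseteq \mathcal G_p(\mathbb R^{2p})$ be the set of maximal isotropic subspaces of $\mathbb R^{p,p}$. Let $V,W\in S$, and suppose that $V$ and $W$ lie in the same connected component of $S$ if $p$ is odd, and in different connected components of $S$ if $p$ is even. Then $$gV\cap W\neq 0\quad\text{for all } g\in\mathrm{SO}(p,p).$$
   Context: $\mathbb R^{p,p}$ is $\mathbb R^{2p}$ with the symmetric bilinear form $\langle x,y\rangle_{p,p}=\sum_{i=1}^p x_iy_i-\sum_{i=1}^p x_{p+i}y_{p+i}$; $\mathrm{SO}(p,p)$ is the group of determinant-one linear maps preserving this form; $\mathcal G_p(\mathbb R^{2p})$ is the Grassmannian of $p$-dimensional subspaces. A subspace is isotropic if the form vanishes identically on it; the maximal isotropic subspaces are the $p$-dimensional ones. The space $S$ (with the topology induced from the Grassmannian) has exactly two connected components. *)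

(* Defs.v *)
From HB Require Import structures.
From mathcomp Require Import all_boot all_order all_algebra.
From mathcomp Require Import all_classical all_reals all_analysis.

Set Implicit Arguments.
Unset Strict Implicit.
Unset Printing Implicit Defensive.

Import Order.TTheory GRing.Theory Num.Theory.
Import numFieldNormedType.Exports.
Local Open Scope classical_set_scope.
Local Open Scope ring_scope.

Definition colspan (R : realType) (k n : nat) (A : 'M[R]_(n, k)) :
    {vspace 'cV[R]_n} :=
  limg (linfun (mulmx A : 'cV[R]_k -> 'cV[R]_n)).

Definition frames (R : realType) (k n : nat) : set 'M[R]_(n, k) :=
  [set A | \rank A = k].

Arguments frames : clear implicits.

Record grassmannian (R : realType) (k n : nat) : Type := Grassmannian {
  subspace_of :> {vspace 'cV[R]_n};
  _ : \dim subspace_of == k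
}.

HB.instance Definition _ (R : realType) (k n : nat) :=
  [isSub for @subspace_of R k n].

Section grassmannian_topology.
Local Open Scope quotient_scope.
Variables (R : realType) (k n : nat).

Lemma dim_colspan (A : 'M[R]_(n, k)) : (\dim (colspan A) == k) = (\rank A == k).
Proof.
have dimk : \dim {: 'cV[R]_k} = k by rewrite dimvf /dim /= muln1.
have := limg_ker_dim (linfun (mulmx A : 'cV[R]_k -> 'cV[R]_n)) fullv.
rewrite capfv dimk -/(colspan A) => dimA.
have -> : (\dim (colspan A) == k) =
    (lker (linfun (mulmx A : 'cV[R]_k -> 'cV[R]_n)) == 0%VS).
  by rewrite -dimv_eq0 -{2}dimA -{1}[\dim (colspan A)]add0n eqn_add2r eq_sym.
rewrite -mxrank_tr; apply/eqP/idP => [ker0|freeA].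
  rewrite -[_ == _]/(row_free A^T) -kermx_eq0; apply/eqP/row_matrixP => i.
  rewrite row0; apply: trmx_inj; rewrite trmx0; apply/eqP.
  rewrite -memv0 -ker0 memv_ker lfunE /=.
  have := congr1 trmx (congr1 (row i) (mulmx_ker A^T)).
  by rewrite row_mul trmx_mul trmxK row0 trmx0 => ->.
apply/eqP; rewrite -subv0; apply/subvP => x; rewrite memv_ker lfunE /= memv0.
move=> /eqP Ax; apply/eqP/trmx_inj/eqP; rewrite trmx0.
apply/eqP/(row_free_inj freeA).
by rewrite mul0mx -trmx_mul Ax trmx0.
Qed.

Lemma grass_of_frame_subproof (A : frames R k n) : \dim (colspan (\val A)) == k.
Proof. by rewrite dim_colspan; apply/eqP; case: A => A /= /set_mem. Qed.

Definition grass_of_frame (A : frames R k n) : grassmannian R k n :=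
  Grassmannian (grass_of_frame_subproof A).

Lemma grass_of_frame_surj (V : grassmannian R k n) :
  exists A, grass_of_frame A = V.
Proof.
case: V => V dimV.
pose A : 'M[R]_(n, k) := \matrix_(i, j) (vbasis V)`_j i 0.
have colA j : col j A = (vbasis V)`_j.
  by apply/colP => i; rewrite !mxE.
have spanA : colspan A = V.
  apply/eqP; rewrite eqEsubv; apply/andP; split.
    apply/subvP => _ /memv_imgP[x _ ->]; rewrite lfunE /=.
    have -> : A *m x = \sum_j x j 0 *: (vbasis V)`_j.
      apply/colP => i; rewrite mxE summxE; apply: eq_bigr => j _.
      by rewrite !mxE mulrC.
    apply: memv_suml => j _; apply: memvZ; apply: vbasis_mem.
    by apply: mem_nth; rewrite size_tuple (eqP dimV).
  rewrite -{1}(span_basis (vbasisP V)); apply/span_subvP => v vV.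
  have ltk : (index v (vbasis V) < k)%N.
    by rewrite -(eqP dimV) -{2}(size_tuple (vbasis V)) index_mem.
  rewrite -(nth_index 0 vV) -[index _ _]/(nat_of_ord (Ordinal ltk)) -colA.
  by rewrite colE; apply/memv_imgP; exists (delta_mx (Ordinal ltk) 0);
    rewrite ?memvf // lfunE.
have rkA : frames R k n A by apply/eqP; rewrite -dim_colspan spanA.
exists (exist _ A (mem_set rkA)); exact/val_inj.
Qed.

Definition frame_of_grass (V : grassmannian R k n) : frames R k n :=
  projT1 (cid (grass_of_frame_surj V)).

Lemma frame_of_grassK : cancel frame_of_grass grass_of_frame.
Proof. by move=> V; rewrite /frame_of_grass; case: cid. Qed.

HB.instance Definition _ :=
  isQuotient.Build (frames R k n) (grassmannian R k n) frame_of_grassK.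

(* The Grassmannian carries the quotient topology of the Stiefel manifold of
   n x k matrices of rank k under A |-> column space of A. *)
HB.instance Definition _ := Topological.copy (grassmannian R k n)
  (quotient_topology (grassmannian R k n)).

Lemma open_grassmannianE (U : set (grassmannian R k n)) :
  open U <-> open (grass_of_frame @^-1` U).
Proof.
have <- : \pi_(grassmannian R k n) = grass_of_frame by rewrite unlock.
by split.
Qed.

End grassmannian_topology.

Section split_form.
Variables (R : realType) (p : nat).

Definition form_pp (x y : 'cV[R]_(p + p)) : R :=
  \sum_(i < p) x (lshift p i) 0 * y (lshift p i) 0 -
  \sum_(i < p) x (rshift p i) 0 * y (rshift p i) 0.

Definition SO_pp : set 'M[R]_(p + p) :=
  [set g | \det g = 1 /\
    forall x y : 'cV[R]_(p + p), form_pp (g *m x) (g *m y) = form_pp x y].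

Definition isotropic (U : {vspace 'cV[R]_(p + p)}) : Prop :=
  forall x y, x \in U -> y \in U -> form_pp x y = 0.

Definition maximal_isotropic (U : {vspace 'cV[R]_(p + p)}) : Prop :=
  isotropic U /\
  forall U' : {vspace 'cV[R]_(p + p)}, isotropic U' -> (U <= U')%VS -> U' = U.

Definition max_isotropic_grass : set (grassmannian R p (p + p)) :=
  [set V | maximal_isotropic V].

Lemma isotropic_dim (U : {vspace 'cV[R]_(p + p)}) :
  isotropic U -> (\dim U <= p)%N.
Proof.
move=> isoU; pose f := linfun (usubmx : 'cV[R]_(p + p) -> 'cV[R]_p).
have /limg_dim_eq <- : (U :&: lker f = 0)%VS.
  apply/eqP; rewrite -subv0; apply/subvP => x.
  rewrite memv_cap memv_ker lfunE /= memv0 => /andP[xU /eqP x0].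
  have xl i : x (lshift p i) 0 = 0.
    by move/matrixP: x0 => /(_ i 0); rewrite !mxE.
  have := isoU x x xU xU; rewrite /form_pp big1; last first.
    by move=> i _; rewrite xl mul0r.
  move=> /eqP; rewrite sub0r oppr_eq0 psumr_eq0; last first.
    by move=> i _; rewrite -expr2 sqr_ge0.
  move=> /allP xr; apply/eqP/colP => i; rewrite mxE.
  case: (split_ordP i) => j ->; first exact: xl.
  by have := xr j (mem_index_enum _); rewrite mulf_eq0 orbb => /eqP.
by apply: (leq_trans (dimvS (subvf _))); rewrite dimvf /dim /= muln1.
Qed.

Lemma max_isotropic_grassE (V : grassmannian R p (p + p)) :
  max_isotropic_grass V <-> isotropic V.
Proof.
split=> [[]//|isoV]; split=> // U' isoU' VU'; apply/esym/eqP.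
rewrite eqEdim VU' /=; case: V isoV VU' => /= V /eqP -> _ _.
exact: isotropic_dim.
Qed.

End split_form.

Arguments max_isotropic_grass : clear implicits.
Arguments SO_pp : clear implicits.

(* Main.v *)
Require Import Defs.
From HB Require Import structures.
From mathcomp Require Import all_boot all_order all_algebra.
From mathcomp Require Import perm.
From mathcomp Require Import all_classical all_reals all_analysis.

Set Implicit Arguments.
Unset Strict Implicit.
Unset Printing Implicit Defensive.

Import Order.TTheory GRing.Theory Num.Theory.
Import numFieldNormedType.Exports.
Local Open Scope classical_set_scope.
Local Open Scope ring_scope.

(** The idea is to encode a maximal isotropic subspace by an orthogonal matrix.
    On an isotropic subspace the first p coordinates and the last p coordinates
    have the same Euclidean norm, so a p-dimensional one is the graph
    [{(x, A x)}] of an orthogonal matrix [A] ([isotropic_frameP],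
    [max_isotropic_graphP]).  Everything is then decided by the sign of [\det A].

    - The graphs of [A] and [B] meet nontrivially as soon as [A y = B y] for some
      nonzero [y].  Since [A^T (A - B) B^T = - (A - B)^T], comparing determinants
      forces [\det (A - B) = 0] when [\det A * \det B = - (-1) ^ p]
      ([orthogonal_agree]).

    - A form-preserving [g] with [\det g = 1] sends the graph of [A] to the graph
      of an [A'] with [\det A' = \det A] ([SO_graph_mx]).  This does not come
      from connectedness, as SO(p,p) is disconnected; it results from computing
      in two ways how [g] acts on the complementary graphs of [A] and [- A], once
      through the determinant of the two frames side by side and once through
      their pairing under the form ([det_graph_mx_preserved]).

    - The sign of [\det A] is exactly the connected component.  It is locally
      constant, because it is the sign of the product of the two p-minors of any
      frame, upper and lower, which is an open condition on the Grassmannian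
      ([same_component_det]).  Conversely, if [\det A = \det B] then [A B^T] is a
      product of an even number of reflections; the vector of a reflection can
      be moved to any other nonzero vector through nonzero vectors, so the
      reflections can be cancelled in pairs ([det_same_component]).

    The hypothesis on the components hence says exactly that
    [\det A * \det B = - (-1) ^ p], a relation which survives the passage from
    [A] to [A'], and the agreement vector of [A'] and [B] gives a nonzero vector
    of the intersection. *)

(** * Column spaces and frames *)
Lemma mem_colspan (R : realType) (k n : nat) (X : 'M[R]_(n, k)) (v : 'cV[R]_n) :
  (v \in colspan X) <-> exists y, v = X *m y.
Proof.
split=> [/memv_imgP[y _ ->]|[y ->]]; first by exists y; rewrite lfunE.
by apply/memv_imgP; exists y; rewrite ?memvf // lfunE.
Qed.

Lemma colspan_mulmxr (R : realType) (k n : nat) (X : 'M[R]_(n, k)) (P : 'M[R]_k) :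
  P \in unitmx -> colspan (X *m P) = colspan X.
Proof.
move=> uP; apply/vspaceP => v; apply/idP/idP => /mem_colspan[y ->];
  apply/mem_colspan; first by exists (P *m y); rewrite mulmxA.
by exists (invmx P *m y); rewrite mulmxA mulmxK.
Qed.

Lemma colspan_inj_frame (R : realType) (k n : nat) (X Y : 'M[R]_(n, k)) :
  \rank X = k -> colspan X = colspan Y ->
  exists2 P, P \in unitmx & X = Y *m P.
Proof.
move=> rX eqXY.
have colXP (j : 'I_k) : exists y, col j X = Y *m y.
  by apply/mem_colspan; rewrite -eqXY; apply/mem_colspan;
    exists (delta_mx j 0); rewrite -colE.
have [y yP] := choice colXP.
pose P := \matrix_(i, j) y j i 0.
have XYP : X = Y *m P.
  apply/matrixP => i j; have /matrixP/(_ i 0) := yP j; rewrite !mxE => ->.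
  by apply: eq_bigr => l _; rewrite !mxE.
exists P => //; rewrite -row_full_unit /row_full eqn_leq rank_leq_row /=.
by rewrite -{1}rX {1}XYP mxrankM_maxr.
Qed.

(** * The split form and graphs of orthogonal matrices *)

Definition form_mx (R : pzRingType) (p : nat) : 'M[R]_(p + p) :=
  block_mx 1%:M 0 0 (- 1%:M).
Arguments form_mx : clear implicits.

Definition graph_mx (R : pzRingType) (p : nat) (A : 'M[R]_p) : 'M[R]_(p + p, p) :=
  col_mx 1%:M A.

Definition orthogonal_mx (R : pzRingType) (p : nat) (A : 'M[R]_p) : Prop :=
  A^T *m A = 1%:M.

Lemma mx11_eq0 (R : pzRingType) (M : 'M[R]_1) : M 0 0 = 0 -> M = 0.
Proof. by move=> M0; apply/matrixP => i j; rewrite !ord1 M0 mxE. Qed.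

Lemma form_mx_col (R : pzRingType) (p m k : nat) (X1 X2 : 'M[R]_(p, m))
    (Y1 Y2 : 'M[R]_(p, k)) :
  (col_mx X1 X2)^T *m form_mx R p *m col_mx Y1 Y2 = X1^T *m Y1 - X2^T *m Y2.
Proof.
rewrite tr_col_mx mul_row_block mul_row_col !mulmx0 addr0 add0r.
by rewrite mulmxN !mulmx1 mulNmx.
Qed.

Lemma form_ppE (R : realType) (p : nat) (x y : 'cV[R]_(p + p)) :
  form_pp x y = (x^T *m form_mx R p *m y) 0 0.
Proof.
rewrite -{2}[x]vsubmxK -{2}[y]vsubmxK form_mx_col !mxE; congr (_ - _);
  by apply: eq_bigr => i _; rewrite !mxE.
Qed.

Lemma bilinear_mx_inj (R : pzRingType) (m n : nat) (M N : 'M[R]_(m, n)) :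
  (forall (x : 'cV[R]_m) (y : 'cV[R]_n), (x^T *m M *m y) 0 0 = (x^T *m N *m y) 0 0) -> M = N.
Proof.
move=> eqMN; apply/matrixP => i j.
have := eqMN (delta_mx i 0) (delta_mx j 0).
by rewrite !trmx_delta -!mulmxA -!colE -!rowE !mxE.
Qed.

Lemma isotropic_colspan (R : realType) (p k : nat) (X : 'M[R]_(p + p, k)) :
  isotropic (colspan X) <-> X^T *m form_mx R p *m X = 0.
Proof.
split=> [isoX|X0 _ _ /mem_colspan[x ->] /mem_colspan[y ->]].
  apply: bilinear_mx_inj => x y.
  have := isoX (X *m x) (X *m y); rewrite form_ppE trmx_mul !mulmxA => ->.
  - by rewrite mulmx0 mul0mx mxE.
  - by apply/mem_colspan; exists x.
  - by apply/mem_colspan; exists y.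
rewrite form_ppE trmx_mul -!mulmxA [form_mx _ _ *m _]mulmxA.
by rewrite [X^T *m (_ *m _)]mulmxA [X^T *m _]mulmxA X0 mul0mx mulmx0 mxE.
Qed.

Lemma mulmx_tr_eq0 (R : realType) (n : nat) (w : 'rV[R]_n) :
  w *m w^T = 0 -> w = 0.
Proof.
move=> /matrixP/(_ 0 0)/eqP; rewrite !mxE psumr_eq0 => [/allP w0|i _].
  apply/rowP => i; have := w0 i (mem_index_enum _).
  by rewrite !mxE mulf_eq0 orbb => /eqP.
by rewrite mxE -expr2 sqr_ge0.
Qed.

(** For a frame with upper block [X1] and lower block [X2], isotropy reads
    [X1^T X1 = X2^T X2].  A vector killed by [X1] is then killed by [X2], so by
    the rank hypothesis [X1] is invertible, and [X2 X1^-1] is orthogonal. *)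
Lemma isotropic_frameP (R : realType) (p : nat) (X : 'M[R]_(p + p, p)) :
  \rank X = p -> isotropic (colspan X) ->
  exists2 A, orthogonal_mx A & exists2 P, P \in unitmx & X = graph_mx A *m P.
Proof.
move=> rX /isotropic_colspan; rewrite -[X]vsubmxK form_mx_col.
set X1 := usubmx X; set X2 := dsubmx X => /eqP; rewrite subr_eq0 => /eqP isoX.
have uX1 : X1 \in unitmx.
  rewrite -unitmx_tr unitmxE unitfE; apply/negP => /det0P[v v0 vX1].
  have vX2 : v *m X2^T = 0.
    by apply: mulmx_tr_eq0; rewrite trmx_mul trmxK mulmxA -[_ *m X2]mulmxA -isoX
      mulmxA vX1 !mul0mx.
  have rfX : row_free X^T by rewrite /row_free mxrank_tr rX.
  case/eqP: v0; apply: (row_free_inj rfX).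
  by rewrite mul0mx -[X]vsubmxK tr_col_mx mul_mx_row vX1 vX2 row_mx0.
exists (X2 *m invmx X1).
  rewrite /orthogonal_mx trmx_mul mulmxA -[_ *m X2]mulmxA -isoX.
  by rewrite trmx_inv mulmxA mulVmx ?unitmx_tr // mul1mx mulmxV.
exists X1 => //; rewrite /graph_mx mul_col_mx mul1mx.
by rewrite -mulmxA mulVmx // mulmx1.
Qed.

(** * Invariance of the determinant under SO(p,p) *)

Lemma det_row_graph_mx (R : realType) (p : nat) (A B : 'M[R]_p) :
  \det (row_mx (graph_mx A) (graph_mx B)) = \det (B - A).
Proof.
have -> : row_mx (graph_mx A) (graph_mx B) =
    block_mx 1%:M 0 A 1%:M *m block_mx 1%:M 1%:M 0 (B - A).
  rewrite mulmx_block !mul1mx !mul0mx !mulmx1 !addr0 [A + _]addrC subrK.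
  by rewrite -block_mxEh.
by rewrite det_mulmx det_lblock det_ublock !det1 !mul1r.
Qed.

(** Two relations between the same quantities hold: determinants of frames side
    by side give [\det (B - A) = \det (B' - A') * \det P * \det Q], while the
    invariance of the pairing, [- C^T (D - C)] for the graphs of [C] and [D],
    gives the same relation with [\det A] and [\det A'] as extra factors.  The
    difference [B - A] being invertible, these factors are equal. *)
Lemma det_graph_mx_preserved (R : realType) (p : nat) (g : 'M[R]_(p + p))
    (A B A' B' P Q : 'M[R]_p) :
  \det g = 1 -> g^T *m form_mx R p *m g = form_mx R p ->
  orthogonal_mx A -> orthogonal_mx A' -> \det (B - A) != 0 ->
  g *m graph_mx A = graph_mx A' *m P -> g *m graph_mx B = graph_mx B' *m Q ->
  \det A' = \det A.
Proof.
move=> dg gJ oA oA' D0 gA gB.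
have DE : \det (B - A) = \det (B' - A') * (\det P * \det Q).
  rewrite -!det_row_graph_mx -[LHS]mul1r -dg -det_mulmx mul_mx_row gA gB.
  rewrite -(det_ublock P 0 Q) -det_mulmx mul_row_block !mulmx0 addr0 add0r.
  by [].
have pairE (C D : 'M[R]_p) : orthogonal_mx C ->
    (graph_mx C)^T *m form_mx R p *m graph_mx D = - (C^T *m (D - C)).
  by rewrite /orthogonal_mx form_mx_col mulmxBr opprB trmx1 mul1mx => ->.
have : P^T *m (A'^T *m (B' - A')) *m Q = A^T *m (B - A).
  apply: oppr_inj; rewrite -mulNmx -mulmxN -!pairE //.
  rewrite !mulmxA -trmx_mul -gA -[_ *m _ *m Q]mulmxA -gB trmx_mul.
  by rewrite -!mulmxA [g^T *m _]mulmxA [_ *m (g *m _)]mulmxA gJ.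
move=> /(congr1 determinant); rewrite !det_mulmx !det_tr => dE.
apply: (mulIf D0); rewrite -dE DE.
by rewrite [in RHS]mulrAC [RHS]mulrC !mulrA.
Qed.

(** * Determinants of orthogonal matrices and agreement *)

Lemma orthogonal_det_sqr (R : realType) (p : nat) (A : 'M[R]_p) :
  orthogonal_mx A -> \det A ^+ 2 = 1.
Proof. by move=> /(congr1 determinant); rewrite det_mulmx det_tr det1 expr2. Qed.

Lemma orthogonal_det (R : realType) (p : nat) (A : 'M[R]_p) :
  orthogonal_mx A -> \det A = 1 \/ \det A = -1.
Proof.
by move=> /orthogonal_det_sqr/eqP; rewrite sqrf_eq1 => /orP[]/eqP; [left|right].
Qed.

Lemma orthogonal_mxC (R : realType) (p : nat) (A : 'M[R]_p) :
  orthogonal_mx A -> A *m A^T = 1%:M.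
Proof. exact: mulmx1C. Qed.

(** The cases p odd with equal determinants and p even with opposite ones: the
    classical statement that the rotation or reflection [A^T B] has a fixed
    vector. *)
Lemma orthogonal_agree (R : realType) (p : nat) (A B : 'M[R]_p) :
  orthogonal_mx A -> orthogonal_mx B ->
  \det A * \det B = - (-1) ^+ p -> exists2 y : 'cV[R]_p, y != 0 & A *m y = B *m y.
Proof.
move=> oA oB dAB.
have dA : \det A ^+ 2 = 1 := orthogonal_det_sqr oA.
have D0 : \det (A - B)^T == 0.
  rewrite det_tr.
  have : A^T *m (A - B) *m B^T = - (A - B)^T.
    rewrite mulmxBr mulmxBl oA mul1mx -mulmxA (orthogonal_mxC oB) mulmx1.
    by rewrite linearB /= opprB.
  move=> /(congr1 determinant); rewrite -[in RHS]scaleN1r detZ !det_mulmx !det_tr.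
  rewrite mulrAC dAB mulNr => /eqP; rewrite eq_sym -addr_eq0 -mulr2n.
  by rewrite mulrn_eq0 mulf_eq0 signr_eq0.
have /det0P[v v0 vAB] := D0.
exists v^T; first by rewrite -(inj_eq trmx_inj) trmxK trmx0.
apply/eqP; rewrite -subr_eq0 -mulmxBl.
by rewrite -[A - B]trmxK -trmx_mul vAB trmx0.
Qed.

(** * Action of SO(p,p) on graphs *)

Lemma mxrank_graph_mx (R : realType) (p : nat) (A : 'M[R]_p) :
  \rank (graph_mx A) = p.
Proof.
suff /eqP : row_full (graph_mx A) by [].
apply/row_fullP; exists (row_mx 1%:M 0).
by rewrite mul_row_col mul1mx mul0mx addr0.
Qed.

Lemma isotropic_graph_mx (R : realType) (p : nat) (A : 'M[R]_p) :
  orthogonal_mx A -> isotropic (colspan (graph_mx A)).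
Proof.
by move=> oA; apply/isotropic_colspan; rewrite form_mx_col oA trmx1 mul1mx subrr.
Qed.

Lemma SO_graph_mx (R : realType) (p : nat) (g : 'M[R]_(p + p)) (A : 'M[R]_p) :
  SO_pp R p g -> orthogonal_mx A ->
  exists A' : 'M[R]_p, [/\ orthogonal_mx A', \det A' = \det A &
    exists2 P, P \in unitmx & g *m graph_mx A = graph_mx A' *m P].
Proof.
move=> [dg gform] oA.
have gJ : g^T *m form_mx R p *m g = form_mx R p.
  apply: bilinear_mx_inj => x y; rewrite -form_ppE -gform form_ppE trmx_mul.
  by rewrite !mulmxA.
have frameP (B : 'M[R]_p) : orthogonal_mx B -> exists2 B', orthogonal_mx B' &
    exists2 P, P \in unitmx & g *m graph_mx B = graph_mx B' *m P.
  move=> oB; apply: isotropic_frameP.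
    rewrite -mxrank_tr trmx_mul mxrankMfree ?mxrank_tr ?mxrank_graph_mx //.
    by rewrite row_free_unit unitmx_tr unitmxE dg unitr1.
  apply/isotropic_colspan; rewrite trmx_mul -!mulmxA.
  rewrite [g^T *m _]mulmxA [_ *m (g *m _)]mulmxA gJ mulmxA.
  by apply/isotropic_colspan; apply: isotropic_graph_mx.
(* The graph of - A is complementary to that of A: their difference is 2 A. *)
have oNA : orthogonal_mx (- A).
  by rewrite /orthogonal_mx [(- A)^T]linearN /= mulmxN mulNmx opprK.
have [A' oA' [P uP gA]] := frameP _ oA.
have [B' oB' [Q uQ gB]] := frameP _ oNA.
exists A'; split=> //; last by exists P.
apply: (det_graph_mx_preserved dg gJ oA oA' _ gA gB).
rewrite -opprD -mulr2n -scaler_nat -scaleNr detZ mulf_neq0 //.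
  by rewrite expf_neq0 // oppr_eq0 pnatr_eq0.
by rewrite -sqrf_eq0 orthogonal_det_sqr // oner_eq0.
Qed.

(** * Reflections generate the orthogonal group *)

Definition sqnorm (R : pzRingType) (n : nat) (u : 'cV[R]_n) : R :=
  (u^T *m u) 0 0.

Definition reflection (R : unitRingType) (n : nat) (u : 'cV[R]_n) : 'M[R]_n :=
  1%:M - (2 / sqnorm u) *: (u *m u^T).

Lemma sqnorm_eq0 (R : realType) (n : nat) (u : 'cV[R]_n) :
  (sqnorm u == 0) = (u == 0).
Proof.
apply/eqP/eqP => [u0|->]; last by rewrite /sqnorm mulmx0 mxE.
apply: trmx_inj; rewrite trmx0; apply: mulmx_tr_eq0.
by rewrite trmxK; apply: mx11_eq0.
Qed.

Lemma tr_reflection (R : realType) (n : nat) (u : 'cV[R]_n) :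
  (reflection u)^T = reflection u.
Proof.
by rewrite /reflection linearB linearZ /= trmx1 trmx_mul trmxK.
Qed.

Lemma reflectionK (R : realType) (n : nat) (u : 'cV[R]_n) :
  u != 0 -> reflection u *m reflection u = 1%:M.
Proof.
rewrite -sqnorm_eq0 => u0; rewrite {2}/reflection mulmxBr mulmx1.
rewrite -scalemxAr mulmxA /reflection mulmxBl mul1mx -scalemxAl.
rewrite -[u *m u^T *m u]mulmxA [u^T *m u]mx11_scalar -/(sqnorm u) mul_mx_scalar.
rewrite scalerA divfK // scaler_nat [u *+ 2]mulr2n opprD addrA subrr sub0r.
by rewrite mulNmx scalerN opprK subrK.
Qed.

Lemma orthogonal_reflection (R : realType) (n : nat) (u : 'cV[R]_n) :
  u != 0 -> orthogonal_mx (reflection u).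
Proof. by rewrite /orthogonal_mx tr_reflection; apply: reflectionK. Qed.

Lemma orthogonal_mulmx (R : realType) (n : nat) (A B : 'M[R]_n) :
  orthogonal_mx A -> orthogonal_mx B -> orthogonal_mx (A *m B).
Proof.
rewrite /orthogonal_mx => oA oB.
by rewrite trmx_mul mulmxA -[_ *m A]mulmxA oA mulmx1.
Qed.

(** Both sides are the determinants of block triangular matrices conjugate to
    each other by a unipotent matrix. *)
Lemma det_1_add_rank1 (R : comPzRingType) (n : nat) (u v : 'cV[R]_n) :
  \det (1%:M + u *m v^T) = 1 + (v^T *m u) 0 0.
Proof.
have E : block_mx 1%:M 0 v^T 1%:M *m block_mx (1%:M + u *m v^T) u 0 1%:M
    = block_mx 1%:M u 0 (1%:M + v^T *m u) *m block_mx 1%:M 0 v^T 1%:M.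
  rewrite !mulmx_block !(mul1mx, mulmx1, mul0mx, mulmx0, addr0, add0r).
  by rewrite mulmxDr mulmxDl mulmx1 mul1mx mulmxA [v^T *m u + _]addrC.
move: (congr1 determinant E); rewrite !det_mulmx !det_lblock !det_ublock !det1.
by rewrite !mul1r !mulr1 => ->; rewrite [_ + _]mx11_scalar det_scalar1 !mxE eqxx.
Qed.

Lemma det_reflection (R : realType) (n : nat) (u : 'cV[R]_n) :
  u != 0 -> \det (reflection u) = -1.
Proof.
rewrite -sqnorm_eq0 => u0; rewrite /reflection -scaleNr scalemxAl.
rewrite det_1_add_rank1 -scalemxAr mxE -/(sqnorm u) mulNr divfK //.
by rewrite -[2]/(1 + 1) opprD addrA subrr sub0r.
Qed.

Definition reflection_prod (R : unitRingType) (n : nat) (us : seq 'cV[R]_n)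
    : 'M[R]_n :=
  foldr (fun u => mulmx (reflection u)) 1%:M us.

(** The step of the Cartan-Dieudonne theorem.  With [u = C x - x], the reflection
    in [u] sends [C x] back to [x] and fixes every vector fixed by [C], since
    those are orthogonal to [u].  In matrix terms, [reflection u *m C - 1] is a
    left multiple of [C - 1] that kills [x], while [C - 1] does not. *)
Lemma rank_reflection_mul_lt (R : realType) (n : nat) (C : 'M[R]_n)
    (x : 'cV[R]_n) (u := (C - 1%:M) *m x) :
  orthogonal_mx C -> u != 0 ->
  (\rank (reflection u *m C - 1%:M)%R < \rank (C - 1%:M)%R)%N.
Proof.
move=> oC; have uE : u = (C - 1%:M) *m x by [].
clearbody u => u0; have := u0; rewrite -sqnorm_eq0 => n0.
have uC : u^T *m C = - (x^T *m (C - 1%:M)).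
  rewrite uE trmx_mul linearB /= trmx1 -mulmxA mulmxBl oC mul1mx.
  by rewrite -mulmxN opprB.
have xu : sqnorm u = - 2 * (x^T *m u) 0 0.
  rewrite /sqnorm; have -> : u^T *m u = - (x^T *m u) - u^T *m x.
    by rewrite {2}uE mulmxBl mul1mx mulmxBr mulmxA uC mulNmx -mulmxA -uE.
  rewrite mxE [(- (x^T *m u)) 0 0]mxE [(- (u^T *m x)) 0 0]mxE.
  have -> : (u^T *m x) 0 0 = (x^T *m u) 0 0.
    by rewrite -[u^T *m x]trmxK trmx_mul trmxK mxE.
  by rewrite -opprD mulNr mulr_natl mulr2n.
have DE : reflection u *m C - 1%:M =
    (1%:M + (2 / sqnorm u) *: (u *m x^T)) *m (C - 1%:M).
  rewrite /reflection mulmxBl mulmxDl !mul1mx -!scalemxAl -!mulmxA uC.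
  by rewrite mulmxN scalerN opprK addrAC.
have Dx : (reflection u *m C - 1%:M) *m x = 0.
  rewrite DE -mulmxA -uE mulmxDl mul1mx -scalemxAl -mulmxA.
  rewrite [x^T *m u]mx11_scalar mul_mx_scalar scalerA.
  have -> : 2 / sqnorm u * (x^T *m u) 0 0 = -1.
    apply: (mulIf n0); rewrite mulrAC divfK // xu mulN1r.
    by rewrite mulNr opprK.
  by rewrite scaleN1r subrr.
have : (reflection u *m C - 1%:M < C - 1%:M)%MS.
  rewrite /ltmx {1}DE submxMl; apply/negP => /submxP[F CF].
  by case/eqP: u0; rewrite uE CF -mulmxA Dx mulmx0.
by rewrite ltmxErank => /andP[].
Qed.

Lemma orthogonal_is_reflection_prod (R : realType) (n : nat) (C : 'M[R]_n) :
  orthogonal_mx C ->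
  exists2 us : seq 'cV[R]_n, all (fun u => u != 0) us & C = reflection_prod us.
Proof.
have [k] := ubnP (\rank (C - 1%:M)); elim: k C => // k IH C rC oC.
have [C1|] := eqVneq (C - 1%:M) 0.
  by exists [::] => //=; apply/eqP; rewrite -subr_eq0 C1.
move=> C1; have [x u0] : exists x : 'cV[R]_n, (C - 1%:M) *m x != 0.
  apply: contrapT => /forallNP C0; case/eqP: C1; apply: bilinear_mx_inj => x y.
  rewrite -mulmxA; have /negP/negPn/eqP -> := C0 y.
  by rewrite !mulmx0 mul0mx.
have [||us us0 usE] := IH (reflection ((C - 1%:M) *m x) *m C).
- exact: leq_trans (rank_reflection_mul_lt oC u0) rC.
- by apply: orthogonal_mulmx => //; apply: orthogonal_reflection.
exists ((C - 1%:M) *m x :: us); first by rewrite /= u0.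
by rewrite /= -usE mulmxA reflectionK // mul1mx.
Qed.

Lemma det_reflection_prod (R : realType) (n : nat) (us : seq 'cV[R]_n) :
  all (fun u => u != 0) us -> \det (reflection_prod us) = (-1) ^+ size us.
Proof.
elim: us => [|u us IH] /=; first by rewrite det1.
by move=> /andP[u0 us0]; rewrite det_mulmx det_reflection // IH // exprS.
Qed.

(** * Continuity of matrix operations *)

Lemma continuous_mx (R : realType) (T : topologicalType) (m n : nat)
    (f : T -> 'M[R]_(m, n)) :
  (forall i j, continuous (fun t => f t i j)) -> continuous f.
Proof.
move=> cf t U [P Pnbhs PU].
have : \forall s \near t, forall i j, P i j (f s i j).
  apply: (@filter_forall _ _ (fun i s => forall j, P i j (f s i j))) => i.
  apply: (@filter_forall _ _ (fun j s => P i j (f s i j))) => j.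
  exact: (cf i j t _ (Pnbhs i j)).
by apply: filterS => s Ps; apply: PU.
Qed.

Lemma continuous_entry (R : realType) (T : topologicalType) (m n : nat)
    (f : T -> 'M[R]_(m, n)) (i : 'I_m) (j : 'I_n) :
  continuous f -> continuous (fun t => f t i j).
Proof.
by move=> cf t; apply: (continuous_comp (cf t) (@coord_continuous _ _ _ i j _)).
Qed.

Lemma continuous_mulmx (R : realType) (T : topologicalType) (m n k : nat)
    (f : T -> 'M[R]_(m, n)) (h : T -> 'M[R]_(n, k)) :
  continuous f -> continuous h -> continuous (fun t => f t *m h t).
Proof.
move=> cf ch; apply: continuous_mx => i j.
under eq_fun do rewrite mxE.
apply: continuous_big => [|l _ t]; first exact: add_continuous.
by apply: continuousM; apply: continuous_entry.
Qed.

Lemma continuous_det (R : realType) (n : nat) :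
  continuous (fun A : 'M[R]_n => \det A).
Proof.
apply: continuous_big => [|s _ A]; first exact: add_continuous.
apply: (@continuousM R 'M[R]_n (fun=> (-1) ^+ s)
  (fun B => \prod_i B i (s i))); first exact: cst_continuous.
move: A; apply: continuous_big => [|i _]; first exact: mul_continuous.
exact: coord_continuous.
Qed.

Lemma continuous_reflection (R : realType) (T : topologicalType) (n : nat)
    (f : T -> 'cV[R]_n) :
  continuous f -> (forall t, f t != 0) -> continuous (fun t => reflection (f t)).
Proof.
move=> cf f0.
have ctr : continuous (fun t => (f t)^T).
  apply: continuous_mx => i j; under eq_fun do rewrite mxE.
  exact: continuous_entry.
apply: continuous_mx => i j.
have -> : (fun t => reflection (f t) i j) =
    (fun t => 1%:M i j - 2 / sqnorm (f t) * (f t *m (f t)^T) i j).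
  by apply/funext => t; rewrite /reflection mxE; congr (_ + _);
    rewrite mxE [in LHS]mxE.
move=> t; apply: (@continuousB R R^o T (fun=> 1%:M i j)).
  exact: cst_continuous.
apply: continuousM; last by apply: continuous_entry; apply: continuous_mulmx.
apply: continuousM; first exact: cst_continuous.
apply: continuousV; first by rewrite sqnorm_eq0.
by apply: continuous_entry; apply: continuous_mulmx.
Qed.

(** * Graphs as points of the Grassmannian *)

Lemma continuous_set_type (T U : topologicalType) (A : set U) (f : T -> A) :
  continuous (fun t => \val (f t)) -> continuous f.
Proof.
move=> /continuousP cf; apply/continuousP => _ [B oB <-].
exact: cf.
Qed.

Lemma continuous_grass_of_frame (R : realType) (k n : nat) :
  continuous (@grass_of_frame R k n).
Proof. by apply/continuousP => U /open_grassmannianE. Qed.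

Lemma graph_mx_frame (R : realType) (p : nat) (A : 'M[R]_p) :
  graph_mx A \in frames R p (p + p).
Proof. by apply/mem_set; apply: mxrank_graph_mx. Qed.

Definition graph_grass (R : realType) (p : nat) (A : 'M[R]_p) :
    grassmannian R p (p + p) :=
  grass_of_frame (exist _ (graph_mx A) (graph_mx_frame A)).

Lemma continuous_graph_grass (R : realType) (p : nat) :
  continuous (@graph_grass R p).
Proof.
pose F (A : 'M[R]_p) : frames R p (p + p) :=
  exist _ (graph_mx A) (graph_mx_frame A).
move=> A; apply: (@continuous_comp _ _ _ F); last first.
  exact: continuous_grass_of_frame.
move: A; apply: continuous_set_type; apply: continuous_mx => i j /=.
rewrite /graph_mx; case: (split_ordP i) => l ->.
  under eq_fun do rewrite col_mxEu.
  exact: cst_continuous.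
under eq_fun do rewrite col_mxEd.
exact: coord_continuous.
Qed.

Lemma max_isotropic_graph_grass (R : realType) (p : nat) (A : 'M[R]_p) :
  orthogonal_mx A -> max_isotropic_grass R p (graph_grass A).
Proof. by move=> oA; apply/max_isotropic_grassE/isotropic_graph_mx. Qed.

Lemma max_isotropic_graphP (R : realType) (p : nat)
    (V : grassmannian R p (p + p)) :
  max_isotropic_grass R p V -> exists2 A, orthogonal_mx A & V = graph_grass A.
Proof.
have [[X rX] <-] := grass_of_frame_surj V.
move=> /max_isotropic_grassE /=; have /set_mem rkX := rX.
move=> /(isotropic_frameP rkX)[A oA [P uP XE]].
exists A => //; apply: val_inj => /=.
by rewrite XE colspan_mulmxr.
Qed.

(** * The determinant is constant on connected components *)

(** On the graph of [A] the product of minors below is [\det A].  Using any frame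
    rather than a graph makes the set visibly open on the whole Grassmannian;
    changing the frame multiplies the product by a nonzero square. *)
Definition det_side (R : realType) (p : nat) (s : R) :
    set (grassmannian R p (p + p)) :=
  [set V | exists2 X, grass_of_frame X = V &
     0 < s * (\det (usubmx (\val X)) * \det (dsubmx (\val X)))].
Arguments det_side : clear implicits.

Lemma det_side_frame (R : realType) (p : nat) (s : R) (X : frames R p (p + p)) :
  det_side R p s (grass_of_frame X) <->
  0 < s * (\det (usubmx (\val X)) * \det (dsubmx (\val X))).
Proof.
split=> [[Y]|]; last by exists X.
case: X Y => X rX [Y rY] /(congr1 (@subspace_of _ _ _)) /= YX sY.
have /set_mem rkX := rX.
have [P uP ->] := colspan_inj_frame rkX (esym YX).
have P2_gt0 : 0 < \det P * \det P.
  by rewrite -expr2 exprn_even_gt0 //= -unitfE -unitmxE.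
rewrite -mul_usub_mx -mul_dsub_mx !det_mulmx.
by rewrite mulrACA [s * _]mulrA mulr_gt0.
Qed.

Lemma det_side_graph (R : realType) (p : nat) (s : R) (A : 'M[R]_p) :
  det_side R p s (graph_grass A) <-> 0 < s * \det A.
Proof.
by rewrite /graph_grass det_side_frame /= /graph_mx col_mxKu col_mxKd det1 mul1r.
Qed.

Lemma sign_mul_gt0 (R : realType) (x y : R) :
  x ^+ 2 = 1 -> y ^+ 2 = 1 -> (0 < x * y) = (y == x).
Proof.
have N11 : (-1 == 1 :> R) = false by rewrite lt_eqF // (lt_trans ltrN10 ltr01).
move=> /eqP; rewrite sqrf_eq1 => /orP[]/eqP -> /eqP;
  rewrite sqrf_eq1 => /orP[]/eqP ->;
  by rewrite ?mulrNN ?mulr1 ?mul1r ?eqxx ?[1 == _]eq_sym ?N11 ?ltr01 ?ltr0N1.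
Qed.

Lemma open_det_side (R : realType) (p : nat) (s : R) : open (det_side R p s).
Proof.
apply/open_grassmannianE.
have -> : @grass_of_frame R p (p + p) @^-1` det_side R p s =
    (fun X : frames R p (p + p) =>
      s * (\det (usubmx (\val X)) * \det (dsubmx (\val X)))) @^-1` [set x | 0 < x].
  by apply/seteqP; split=> X /det_side_frame.
apply: open_comp; last exact: open_gt.
move=> X _.
have cval : continuous (\val : frames R p (p + p) -> 'M[R]_(p + p, p)).
  exact: initial_continuous.
apply: (@continuousM R (frames R p (p + p)) (fun=> s)).
  exact: cst_continuous.
apply: (@continuousM R (frames R p (p + p)) (fun X => \det (usubmx (\val X)))
    (fun X => \det (dsubmx (\val X)))).
  apply: (@continuous_comp _ _ _ (fun X : frames R p (p + p) => usubmx (\val X)));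
    last exact: continuous_det.
  move: X; apply: continuous_mx => i j; under eq_fun do rewrite mxE.
  exact: continuous_entry.
apply: (@continuous_comp _ _ _ (fun X : frames R p (p + p) => dsubmx (\val X)));
  last exact: continuous_det.
move: X; apply: continuous_mx => i j; under eq_fun do rewrite mxE.
exact: continuous_entry.
Qed.

(** Among isotropic subspaces the two open conditions of opposite signs are
    complementary, so each of them cuts out a clopen part of a connected set. *)
Lemma same_component_det (R : realType) (p : nat) (A B : 'M[R]_p) :
  orthogonal_mx A -> orthogonal_mx B ->
  connected_component (max_isotropic_grass R p) (graph_grass A) (graph_grass B) ->
  \det A = \det B.
Proof.
move=> oA oB [C [CA CS cC] CB].
pose s := \det A.
have s2 : s ^+ 2 = 1 := orthogonal_det_sqr oA.
have sN2 : (- s) ^+ 2 = 1 by rewrite sqrrN.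
have sNs : (s == - s) = false.
  by rewrite -addr_eq0 -mulr2n mulrn_eq0 -sqrf_eq0 s2 oner_eq0.
have sideE D : orthogonal_mx D -> det_side R p s (graph_grass D) <-> \det D = s.
  move=> /orthogonal_det_sqr dD; rewrite det_side_graph sign_mul_gt0 //.
  by split=> /eqP.
have sideC V : C V -> det_side R p s V <-> ~ det_side R p (- s) V.
  move=> /CS/max_isotropic_graphP[D oD ->]; rewrite sideE // det_side_graph.
  have dD := orthogonal_det_sqr oD; rewrite sign_mul_gt0 //.
  move/eqP: (dD); rewrite -s2 eqf_sqr => /orP[]/eqP ->; split=> //.
  - by rewrite sNs.
  - by move/esym/eqP; rewrite sNs.
have sA : det_side R p s (graph_grass A) by apply/sideE.
have CE : C `&` det_side R p s = C.
  apply: cC; first by exists (graph_grass A).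
    by exists (det_side R p s) => //; apply: open_det_side.
  exists (~` det_side R p (- s)); first exact/open_closedC/open_det_side.
  by apply/seteqP; split=> V [CV /(sideC _ CV)].
apply/esym/sideE => //.
by move: CB; rewrite -CE => -[].
Qed.

(** * Equal determinants give the same component *)

Lemma path_same_component (R : realType) (p : nat) (f : R -> 'M[R]_p) :
  continuous f -> (forall t, orthogonal_mx (f t)) ->
  connected_component (max_isotropic_grass R p)
    (graph_grass (f 0)) (graph_grass (f 1)).
Proof.
move=> cf of_; exists ((graph_grass (p := p) \o f) @` `[0, 1]).
  split.
  - by exists 0; rewrite //= in_itv /= lexx ler01.
  - by move=> _ [t _ <-]; apply: max_isotropic_graph_grass.
  - apply: connected_continuous_connected; first exact: segment_connected.
    apply: continuous_subspaceT => t.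
    by apply: continuous_comp; [exact: cf|exact: continuous_graph_grass].
by exists 1; rewrite //= in_itv /= lexx ler01.
Qed.

Lemma reflectionZ (R : realType) (n : nat) (c : R) (u : 'cV[R]_n) :
  c != 0 -> reflection (c *: u) = reflection u.
Proof.
move=> c0; have cc0 : c * c != 0 by rewrite mulf_neq0.
have trE : (c *: u)^T = c *: u^T by rewrite linearZ.
have sqE : sqnorm (c *: u) = c * c * sqnorm u.
  by rewrite /sqnorm trE -scalemxAl -scalemxAr scalerA mxE.
rewrite /reflection sqE trE -scalemxAl -scalemxAr !scalerA -[_ * c * c]mulrA.
by rewrite invfM [2 * (_ / _)]mulrA mulrAC divfK.
Qed.

Lemma reflection_same_component (R : realType) (p : nat) (D : 'M[R]_p)
    (u v : 'cV[R]_p) :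
  orthogonal_mx D -> u != 0 -> v != 0 ->
  connected_component (max_isotropic_grass R p)
    (graph_grass (reflection u *m D)) (graph_grass (reflection v *m D)).
Proof.
move=> oD u0 v0; have [[c uE]|ncol] := pselect (exists c, u = c *: v).
  have c0 : c != 0 by apply: contra_neq u0 => c0; rewrite uE c0 scale0r.
  rewrite uE reflectionZ //; apply: connected_component_refl.
  apply: max_isotropic_graph_grass.
  by apply: orthogonal_mulmx => //; apply: orthogonal_reflection.
(* The segment from u to v avoids 0 since u is not a multiple of v. *)
pose w (t : R) := (1 - t) *: u + t *: v.
have w0 t : w t != 0.
  have [->|t1] := eqVneq t 1.
    by rewrite /w subrr scale0r add0r scale1r.
  apply/eqP => wt; apply: ncol; exists (- (t / (1 - t))).
  have t10 : 1 - t != 0 by rewrite subr_eq0 eq_sym.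
  apply: (scalerI t10); rewrite scalerA mulrN mulrC divfK // scaleNr.
  by apply/eqP; rewrite -addr_eq0 -wt.
have cw : continuous w.
  apply: continuous_mx => i j; under eq_fun do rewrite !mxE.
  move=> t; apply: (@continuousD R R^o R (fun t => (1 - t) * u i j)).
    apply: (@continuousM R R (fun t => 1 - t)); last exact: cst_continuous.
    apply: (@continuousB R R^o R (fun=> 1)); first exact: cst_continuous.
    exact: cvg_id.
  apply: (@continuousM R R id); first exact: cvg_id.
  exact: cst_continuous.
have := @path_same_component R p (fun t => reflection (w t) *m D) _ _.
rewrite /w subr0 scale1r scale0r addr0 subrr scale0r add0r scale1r; apply.
  apply: continuous_mulmx; last exact: cst_continuous.
  exact: continuous_reflection.
by move=> t; apply: orthogonal_mulmx => //; apply: orthogonal_reflection (w0 t).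
Qed.

(** Moving the first reflection vector of an even product onto the second one
    turns the leading pair of reflections into the identity. *)
Lemma det_same_component (R : realType) (p : nat) (A B : 'M[R]_p) :
  orthogonal_mx A -> orthogonal_mx B -> \det A = \det B ->
  connected_component (max_isotropic_grass R p) (graph_grass A) (graph_grass B).
Proof.
move=> oA oB dAB.
have [us us0 CE] : exists2 us : seq 'cV[R]_p,
    all (fun u => u != 0) us & A *m B^T = reflection_prod us.
  apply: orthogonal_is_reflection_prod; apply: orthogonal_mulmx => //.
  by rewrite /orthogonal_mx trmxK; apply: orthogonal_mxC.
have us_even : ~~ odd (size us).
  have := det_reflection_prod us0; rewrite -CE det_mulmx det_tr dAB -expr2.
  rewrite orthogonal_det_sqr // -signr_odd; case: odd => //= /eqP.
  by rewrite expr1 -subr_eq0 opprK -[1 + 1]/(2%:R) pnatr_eq0.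
have -> : A = reflection_prod us *m B by rewrite -CE -mulmxA oB mulmx1.
have [n] := ubnP (size us); elim: n us us0 us_even {CE} => // n IH.
case=> [|u [|v us]] //=.
  move=> _ _ _; rewrite mul1mx; apply: connected_component_refl.
  exact: max_isotropic_graph_grass.
rewrite negbK => /and3P[u0 v0 us0] us_even sz.
have oD : orthogonal_mx (reflection_prod us *m B).
  apply: orthogonal_mulmx => //.
  elim: us us0 {us_even sz} => [_|x us IHus /andP[x0 us0]] /=.
    by rewrite /orthogonal_mx trmx1 mul1mx.
  by apply: orthogonal_mulmx; [exact: orthogonal_reflection|exact: IHus].
have oE : orthogonal_mx (reflection v *m (reflection_prod us *m B)).
  by apply: orthogonal_mulmx => //; apply: orthogonal_reflection.
have := reflection_same_component oE u0 v0.
rewrite [reflection v *m (reflection v *m _)]mulmxA reflectionK // mul1mx.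
rewrite !mulmxA => /connected_component_trans; apply.
by apply: IH => //; rewrite -ltnS ltnW.
Qed.

(** * Intersection of maximal isotropic subspaces *)

Theorem proposition6p1 (R : realType) (p : nat) (hp : (2 <= p)%N)
    (V W : grassmannian R p (p + p))
    (hV : max_isotropic_grass R p V) (hW : max_isotropic_grass R p W)
    (hodd : odd p -> connected_component (max_isotropic_grass R p) V W)
    (heven : ~~ odd p -> ~ connected_component (max_isotropic_grass R p) V W)
    (g : 'M[R]_(p + p)) (hg : SO_pp R p g) :
  ((linfun (mulmx g : 'cV[R]_(p + p) -> 'cV[R]_(p + p)) @: V) :&: W)%VS
    <> 0%VS.
Proof.
have [A oA VE] := max_isotropic_graphP hV.
have [B oB WE] := max_isotropic_graphP hW.
rewrite {}VE {}WE in hodd heven *.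
have dAB : \det A * \det B = - (-1) ^+ p.
  rewrite -signr_odd; case: (boolP (odd p)) => [op|ep].
    have <- := same_component_det oA oB (hodd op).
    by rewrite -expr2 orthogonal_det_sqr // expr1 opprK.
  have /eqP : \det A <> \det B by move=> /(det_same_component oA oB); apply: heven.
  rewrite expr0.
  case: (orthogonal_det oA) (orthogonal_det oB) => -> [->|->];
    by rewrite ?eqxx // ?mulr1 ?mul1r.
have [A' [oA' dA' [P uP gA]]] := SO_graph_mx hg oA.
rewrite -dA' in dAB; have [y y0 AyBy] := orthogonal_agree oA' oB dAB.
have agree : graph_mx A' *m y = graph_mx B *m y.
  by rewrite /graph_mx !mul_col_mx AyBy.
move=> cap0; have : graph_mx B *m y \in (0%VS : {vspace 'cV[R]_(p + p)}).
  rewrite -cap0 memv_cap; apply/andP; split; last by apply/mem_colspan; exists y.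
  apply/memv_imgP; exists (graph_mx A *m (invmx P *m y)).
    by apply/mem_colspan; exists (invmx P *m y).
  by rewrite lfunE /= !mulmxA gA mulmxK.
rewrite memv0 /graph_mx mul_col_mx mul1mx -col_mx0 => /eqP/eq_col_mx[y00 _].
by rewrite y00 eqxx in y0.
Qed.
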